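(* Let $M$ be a smooth $n$-dimensional manifold, let $H:(T_k^1)^*M\to\mathbb{R}$ be a smooth function, and consider the $k$-symplectic Hamiltonian system $\left((T_k^1)^*M,(\omega_0)_A,H\right)$, where $(\omega_0)_1,\dots,(\omega_0)_k$ are the canonical $2$-forms on $(T_k^1)^*M$. Let $\mathbf{X}=(X_1,\dots,X_k)$ be an integrable evolution $k$-vector field associated to $H$, i.e. $\mathbf{X}$ is an integrable $k$-vector field on $(T_k^1)^*M$ with $\sum_{A=1}^{k}i_{X_A}(\omega_0)_A=dH$. Suppose that $L_{X_A}(\omega_0)_A=0$ for each $A=1,\dots,k$ (no summation over $A$). Let $Y$ be a vector field on $(T_k^1)^*M$ which is a symmetry of $\mathbf{X}$, and let $\mathbf{Y}=(Y,\dots,Y)$ be the $k$-vector field on $(T_k^1)^*M$ all of whose $k$ components equal $Y$. If $S$ is a vector field on $(T_k^1)^*M$ which is a $\mathbf{Y}$-pseudosymmetry of $\mathbf{X}$, then the map $\mathbf{\Phi}=(\Phi_1,\dots,\Phi_k)$ defined by $$\Phi_A=(\omega_0)_A(S,Y),\qquad A=1,\dots,k,$$ is a conservation law for $\mathbf{X}=(X_1,\dots,X_k)$. In particular, if $Y$ and $S$ are symmetries of $\mathbf{X}$, then $\mathbf{\Phi}$ is a conservation law for $\mathbf{X}$.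
   Context: All manifolds, maps, vector fields and forms are $C^\infty$. $L_X$ denotes the Lie derivative (for vector fields $L_XY=[X,Y]$) and $i_X$ the interior product. $(T_k^1)^*M=T^*M\oplus\cdots\oplus T^*M$ (Whitney sum of $k$ copies of $T^*M$) is the $k$-cotangent bundle of $M$, with natural coordinates $(x^i,p_i^A)$, $1\le i\le n$, $1\le A\le k$. With $\tau_A^*:(T_k^1)^*M\to T^*M$ the projection on the $A$-th copy, $\theta$ the Liouville $1$-form on $T^*M$ and $\omega=-d\theta$ the canonical symplectic form on $T^*M$, the canonical $2$-forms are $(\omega_0)_A=(\tau_A^* )^*\omega$ (pullback of $\omega$ by $\tau_A^*$), locally $(\omega_0)_A=\sum_i dx^i\wedge dp_i^A$. A $k$-vector field on a manifold $\mathcal{M}$ is a section of the Whitney sum $T\mathcal{M}\oplus\cdots\oplus T\mathcal{M}$ ($k$ copies), i.e. a $k$-tuple $\mathbf{X}=(X_1,\dots,X_k)$ of vector fields on $\mathcal{M}$. An integral section of $\mathbf{X}$ at $x\in\mathcal{M}$ is a map $\psi:U_0\subset\mathbb{R}^k\to\mathcal{M}$, with $U_0$ an open neighbourhood of $0$, such that $\psi(0)=x$ and $\psi_*(t)\left(\frac{\partial}{\partial t^A}(t)\right)=X_A(\psi(t))$ for every $t\in U_0$ and every $A=1,\dots,k$. $\mathbf{X}$ is integrable if there is an integral section at every point of $\mathcal{M}$. A map $\mathbf{\Phi}=(\Phi_1,\dots,\Phi_k):\mathcal{M}\to\mathbb{R}^k$ is a conservation law for the $k$-vector field $\mathbf{X}$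 on $\mathcal{M}$ if $\sum_{A=1}^{k}L_{X_A}\Phi_A=0$. A vector field $Y$ on $\mathcal{M}$ is a symmetry of $\mathbf{X}$ if $L_{X_A}Y=0$ for all $A=1,\dots,k$. Given a fixed $k$-vector field $\mathbf{Z}=(Z_1,\dots,Z_k)$ on $\mathcal{M}$, a vector field $S$ on $\mathcal{M}$ is a $\mathbf{Z}$-pseudosymmetry of $\mathbf{X}$ if for every $A=1,\dots,k$ there are functions $\lambda_A^B\in C^\infty(\mathcal{M})$, $B=1,\dots,k$, such that $L_{X_A}S=\sum_{B=1}^{k}\lambda_A^B Z_B$. *)

(* Defs.v *)
From HB Require Import structures.
From mathcomp Require Import all_boot all_order all_algebra.
From mathcomp Require Import all_classical all_reals all_analysis.
Import Order.TTheory GRing.Theory Num.Theory.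
Import numFieldNormedType.Exports.

Set Implicit Arguments.
Unset Strict Implicit.
Unset Printing Implicit Defensive.

Local Open Scope classical_set_scope.
Local Open Scope ring_scope.

(** Smooth maps between open subsets of Euclidean spaces *)

(* [Ck k U f] is meant for an open set [U]; it does not depend on the values
   of [f] outside [U]. *)
Fixpoint Ck (R : realType) (m : nat) (V : normedModType R) (k : nat)
    (U : set 'rV[R]_m) (f : 'rV[R]_m -> V) : Prop :=
  match k with
  | 0 => forall x, U x -> {for x, continuous f}
  | k'.+1 => (forall x, U x -> differentiable f x) /\
             forall i : 'I_m, Ck k' U (fun x => 'D_('e_i) f x)
  end.

Definition smooth_on (R : realType) (m : nat) (V : normedModType R)
    (U : set 'rV[R]_m) (f : 'rV[R]_m -> V) : Prop :=
  forall k, Ck k U f.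

Section SmoothCalculus.
Context {R : realType}.

Lemma near_eq_differentiable (V W : normedModType R) (f g : V -> W) x :
  {near x, f =1 g} -> differentiable f x -> differentiable g x.
Proof.
move=> fg df.
have E : g \o shift x = cst (g x) + 'd f x +o_ 0 id.
  apply/eqaddoP => e e0.
  have [_ /eqaddoP/(_ e e0)] := (diff_locallyP _ _).1 df.
  have : \forall h \near 0, f (h + x) = g (h + x).
    rewrite (near_shift x) /=.
    by apply: filterS fg => y; rewrite /= sub0r subrK.
  apply: filterS2 => h /= fgh.
  have /= -> := nbhs_singleton fg.
  by rewrite /cst /= !fctE fgh.
apply/diff_locallyP; suff -> : 'd g x = 'd f x :> (V -> W).
  by split=> //; exact: diff_continuous.
by apply: diff_unique E; exact: diff_continuous.
Qed.

Lemma nbhs_open (V : normedModType R) (U : set V) (P : V -> Prop) x :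
  open U -> U x -> (forall y, U y -> P y) -> \forall y \near x, P y.
Proof. by move=> oU Ux UP; apply: filterS (open_nbhs_nbhs (conj oU Ux)). Qed.

Lemma CkS m (V : normedModType R) k (U : set 'rV[R]_m) (f : 'rV[R]_m -> V) :
  Ck k.+1 U f -> Ck k U f.
Proof.
elim: k f => [|k IH] f [df Df].
  by move=> x Ux; apply: differentiable_continuous; exact: df.
split=> // i; apply: IH; exact: Df.
Qed.

Lemma smooth_differentiable m (V : normedModType R) (U : set 'rV[R]_m)
  (f : 'rV[R]_m -> V) x : smooth_on U f -> U x -> differentiable f x.
Proof. by move=> /(_ 1%N)[+ _]; apply. Qed.

Section OpenSet.
Context {m : nat} (U : set 'rV[R]_m) (oU : open U).

Lemma eq_Ck (V : normedModType R) k (f g : 'rV[R]_m -> V) :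
  (forall x, U x -> f x = g x) -> Ck k U f -> Ck k U g.
Proof.
elim: k f g => [|k IH] f g fg.
  move=> cf x Ux.
  rewrite /prop_for /continuous_at -(fg x Ux).
  suff /near_eq_cvg h : {near nbhs x, f =1 g} by apply: cvg_trans (cf x Ux).
  exact: (nbhs_open oU Ux).
move=> [df Df]; split.
  move=> x Ux; apply: near_eq_differentiable (df x Ux).
  exact: (nbhs_open oU Ux).
move=> i; apply: IH (Df i) => x Ux.
by apply: near_eq_derive; exact: (nbhs_open oU Ux).
Qed.

Lemma eq_smooth (V : normedModType R) (f g : 'rV[R]_m -> V) :
  (forall x, U x -> f x = g x) -> smooth_on U f -> smooth_on U g.
Proof. by move=> fg sf k; exact: eq_Ck (sf k). Qed.

Lemma Ck_cst (V : normedModType R) k (c : V) : Ck k U (cst c).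
Proof.
elim: k c => [|k IH] c /=; first by move=> x _; exact: cst_continuous.
split=> [x _|i]; first exact: differentiable_cst.
by apply: eq_Ck (IH 0) => x _; rewrite derive_cst.
Qed.

Lemma CkD (V : normedModType R) k (f g : 'rV[R]_m -> V) :
  Ck k U f -> Ck k U g -> Ck k U (f \+ g).
Proof.
elim: k f g => [|k IH] f g.
  by move=> cf cg x Ux; apply: continuousD; [exact: cf|exact: cg].
move=> [df Df] [dg Dg]; split=> [x Ux|i].
  by apply: differentiableD; [exact: df|exact: dg].
apply: eq_Ck (IH _ _ (Df i) (Dg i)) => x Ux /=.
by rewrite deriveD//; apply: diff_derivable; [exact: df|exact: dg].
Qed.

Lemma CkM k (f g : 'rV[R]_m -> R) :
  Ck k U f -> Ck k U g -> Ck k U (f \* g).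
Proof.
elim: k f g => [|k IH] f g.
  by move=> cf cg x Ux; apply: continuousM; [exact: cf|exact: cg].
move=> Cf Cg; have [df Df] := Cf; have [dg Dg] := Cg; split=> [x Ux|i].
  by apply: differentiableM; [exact: df|exact: dg].
apply: eq_Ck (CkD (IH _ _ (CkS Cf) (Dg i)) (IH _ _ (CkS Cg) (Df i))) => x Ux /=.
by rewrite deriveM//; apply: diff_derivable; [exact: df|exact: dg].
Qed.

Lemma Ck_sum (V : normedModType R) k (I : Type) (r : seq I)
    (f : I -> 'rV[R]_m -> V) :
  (forall i, Ck k U (f i)) -> Ck k U (fun x => \sum_(i <- r) f i x).
Proof.
move=> Cf; elim: r => [|i r IH].
  by apply: eq_Ck (Ck_cst k 0) => x _; rewrite big_nil.
by apply: eq_Ck (CkD (Cf i) IH) => x _ /=; rewrite big_cons.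
Qed.

Lemma CkZl (V : normedModType R) k (f : 'rV[R]_m -> R) (v : V) :
  Ck k U f -> Ck k U (fun x => f x *: v).
Proof.
elim: k f => [|k IH] f.
  by move=> cf x Ux; apply: continuousZl; exact: cf.
move=> [df Df]; split=> [x Ux|i].
  by apply: differentiableZl; exact: df.
apply: eq_Ck (IH _ (Df i)) => x Ux /=.
rewrite !deriveE; [|by apply: differentiableZl; exact: df|exact: df].
by rewrite diffZl//; exact: df.
Qed.

Lemma Ck_row n k (f : 'rV[R]_m -> 'rV[R]_n) :
  (forall j, Ck k U (fun x => f x 0 j)) -> Ck k U f.
Proof.
move=> Cf; apply: (@eq_Ck _ k (fun x => \sum_j f x 0 j *: 'e_j)).
  by move=> x _; rewrite -row_sum_delta.
by apply: Ck_sum => j; apply: CkZl; exact: Cf.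
Qed.

Lemma Ck_coord k (j : 'I_m) : Ck k U (fun x => x 0 j).
Proof.
case: k => [|k]; first by move=> x _; exact: coord_continuous.
split=> [x _|i]; first exact: differentiable_coord.
apply: (@eq_Ck _ k (cst (('e_i : 'rV[R]_m) 0 j))); last exact: Ck_cst.
move=> x _; rewrite /cst.
have /(congr1 (fun A : 'rV[R]_m => A 0 j)) := derive_mx (@derivable_id _ _ x 'e_i).
by rewrite derive_id !mxE.
Qed.

Lemma Ck_coord_comp n k (f : 'rV[R]_m -> 'rV[R]_n) j :
  Ck k U f -> Ck k U (fun x => f x 0 j).
Proof.
elim: k f => [|k IH] f.
  move=> cf x Ux.
  apply: (@continuous_comp _ _ _ f (fun y : 'rV[R]_n => y 0 j)).
    exact: cf.
  exact: coord_continuous.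
move=> [df Df]; split=> [x Ux|i].
  apply: (differentiable_comp (g := fun y : 'rV[R]_n => y 0 j)).
    exact: df.
  exact: differentiable_coord.
apply: eq_Ck (IH _ (Df i)) => x Ux /=.
by rewrite derive_mx ?mxE//; apply: diff_derivable; exact: df.
Qed.

Lemma derive_sum_coord p (V : normedModType R) (f : 'rV[R]_p -> V) x v :
  differentiable f x -> 'D_v f x = \sum_j v 0 j *: 'D_('e_j) f x.
Proof.
move=> df; rewrite {1}(row_sum_delta v) deriveE// linear_sum.
by apply: eq_bigr => j _; rewrite linearZ deriveE.
Qed.

Lemma derive_comp p (V : normedModType R) (W : normedModType R)
    (f : 'rV[R]_p -> V) (g : W -> 'rV[R]_p) x v :
  differentiable g x -> differentiable f (g x) ->
  'D_v (f \o g) x = 'D_('D_v g x) f (g x).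
Proof.
move=> dg df; rewrite !deriveE//; last exact: differentiable_comp.
by rewrite diff_comp.
Qed.

Lemma Ck_comp p k (W : set 'rV[R]_p) (f : 'rV[R]_p -> R)
    (g : 'rV[R]_m -> 'rV[R]_p) :
  (forall x, U x -> W (g x)) -> Ck k W f -> Ck k U g -> Ck k U (f \o g).
Proof.
move=> UW; elim: k f g UW => [|k IH] f g UW.
  move=> cf cg x Ux; apply: continuous_comp; first exact: cg.
  by apply: cf; exact: UW.
move=> [df Df] Cg; have [dg Dg] := Cg; split=> [x Ux|i].
  apply: differentiable_comp; first exact: dg.
  by apply: df; exact: UW.
apply: (@eq_Ck _ k (fun x => \sum_j 'D_('e_i) g x 0 j * 'D_('e_j) f (g x))).
  move=> x Ux; have dgx := dg x Ux; have dfx := df _ (UW _ Ux).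
  by rewrite (derive_comp _ dgx dfx) (derive_sum_coord _ dfx).
apply: Ck_sum => j; apply: (@CkM k (fun x => 'D_('e_i) g x 0 j)).
  by apply: (@Ck_coord_comp p k (fun x => 'D_('e_i) g x)); exact: Dg.
by apply: (IH (fun y => 'D_('e_j) f y) g UW); [exact: Df|exact: CkS Cg].
Qed.

Lemma smooth_row n (f : 'rV[R]_m -> 'rV[R]_n) :
  (forall j, smooth_on U (fun x => f x 0 j)) -> smooth_on U f.
Proof. by move=> sf k; apply: Ck_row => j; exact: sf. Qed.

Lemma smooth_derive (V : normedModType R) (f : 'rV[R]_m -> V) i :
  smooth_on U f -> smooth_on U (fun x => 'D_('e_i) f x).
Proof. by move=> sf k; have [_ ] := sf k.+1; apply. Qed.

End OpenSet.

Lemma smooth_comp m p q (U : set 'rV[R]_m) (W : set 'rV[R]_p)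
    (f : 'rV[R]_p -> 'rV[R]_q) (g : 'rV[R]_m -> 'rV[R]_p) :
  open U -> open W -> (forall x, U x -> W (g x)) ->
  smooth_on W f -> smooth_on U g -> smooth_on U (f \o g).
Proof.
move=> oU oW UW sf sg; apply: smooth_row => // j k.
by apply: (@Ck_comp _ _ oU _ _ W (fun y => f y 0 j)) => //; exact: Ck_coord_comp.
Qed.

End SmoothCalculus.

(** Smooth manifolds *)

(* A set with a smooth atlas modelled on [R^n].  [chart_inv a] is only
   meaningful on [chart a @` chart_dom a], where it is the inverse of
   [chart a].  Smooth maps, vector fields and forms only depend on this data;
   Hausdorffness and second countability are added in [manifold] below. *)
Record smoothAtlas (R : realType) (n : nat) := SmoothAtlas {
  pt :> Type;
  idx : Type;
  chart_dom : idx -> set pt;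
  chart : idx -> pt -> 'rV[R]_n;
  chart_inv : idx -> 'rV[R]_n -> pt;
  chartK : forall a x, chart_dom a x -> chart_inv a (chart a x) = x;
  atlas_cover : forall x, exists a, chart_dom a x;
  overlap_open : forall a b, open (chart a @` (chart_dom a `&` chart_dom b));
  transition_smooth : forall a b,
    smooth_on (chart a @` (chart_dom a `&` chart_dom b)) (chart b \o chart_inv a)
}.

Arguments chart_dom {R n M} a _ : rename.
Arguments chart {R n M} a _ : rename.
Arguments chart_inv {R n M} a _ : rename.
Arguments chartK {R n M} a [x] : rename.
Arguments overlap_open {R n} M a b : rename.
Arguments transition_smooth {R n} M a b : rename.

Section AtlasTopology.
Context {R : realType} {n : nat} (M : smoothAtlas R n).
Implicit Types (a b : idx M) (x : pt M) (W : set (pt M)).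

Definition overlap a b : set 'rV[R]_n := chart a @` (chart_dom a `&` chart_dom b).

Definition chart_range a : set 'rV[R]_n := chart a @` chart_dom a.

Lemma overlapxx a : overlap a a = chart_range a.
Proof. by rewrite /overlap setIid. Qed.

Lemma chart_range_open a : open (chart_range a).
Proof. by rewrite -overlapxx; exact: overlap_open. Qed.

Lemma chart_inj a x (y : pt M) :
  chart_dom a x -> chart_dom a y -> chart a x = chart a y -> x = y.
Proof. by move=> ax ay /(congr1 (chart_inv a)); rewrite !chartK. Qed.

Lemma chart_rangeK a y :
  chart_range a y -> chart_dom a (chart_inv a y) /\ chart a (chart_inv a y) = y.
Proof. by move=> [x ax <-]; rewrite chartK. Qed.

Lemma overlapP a b y :
  overlap a b y <-> chart_range a y /\ chart_dom b (chart_inv a y).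
Proof.
split=> [[x [ax bx] <-]|[/chart_rangeK[ay yE] by_]].
  by rewrite chartK//; split=> //; exists x.
by exists (chart_inv a y).
Qed.

Definition atlas_open W : Prop := forall a, open (chart a @` (W `&` chart_dom a)).

Lemma atlas_openT : atlas_open setT.
Proof. by move=> a; rewrite setTI; exact: chart_range_open. Qed.

Lemma atlas_openI : setI_closed atlas_open.
Proof.
move=> A B oA oB a.
rewrite [X in open X](_ : _ =
    chart a @` (A `&` chart_dom a) `&` chart a @` (B `&` chart_dom a)).
  by apply: openI; [exact: oA|exact: oB].
apply/seteqP; split=> [_ [x [[Ax Bx] ax] <-]|_ [[x [Ax ax] <-] [y [By ay] yx]]].
  by split; exists x.
by exists x; split=> //; split=> //; rewrite -(chart_inj ay ax yx).
Qed.

Lemma atlas_open_bigU (I : Type) (W : I -> set (pt M)) :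
  (forall i, atlas_open (W i)) -> atlas_open (\bigcup_i W i).
Proof.
move=> oW a.
rewrite [X in open X](_ : _ = \bigcup_i (chart a @` (W i `&` chart_dom a))).
  by apply: bigcup_open => i _; exact: oW.
apply/seteqP; split=> [_ [x [[i _ Wx] ax] <-]|_ [i _ [x [Wx ax] <-]]].
  by exists i => //; exists x.
by exists x => //; split=> //; exists i.
Qed.

End AtlasTopology.
Arguments chart_range_open {R n M} a.

HB.instance Definition _ (R : realType) (n : nat) (M : smoothAtlas R n) :=
  gen_eqMixin (pt M).
HB.instance Definition _ (R : realType) (n : nat) (M : smoothAtlas R n) :=
  gen_choiceMixin (pt M).
(* The topology for which the charts are homeomorphisms between open sets. *)
HB.instance Definition _ (R : realType) (n : nat) (M : smoothAtlas R n) :=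
  isOpenTopological.Build (pt M) (@atlas_openT R n M) (@atlas_openI R n M)
    (@atlas_open_bigU R n M).

Record manifold (R : realType) (n : nat) := Manifold {
  atlas :> smoothAtlas R n;
  manifold_hausdorff : hausdorff_space (pt atlas);
  manifold_second_countable : @second_countable (pt atlas)
}.

(** Tangent vectors *)

Definition transition (R : realType) (n : nat) (M : smoothAtlas R n)
    (a b : idx M) : 'rV[R]_n -> 'rV[R]_n := chart b \o chart_inv a.

(* A tangent vector at [x] is given by its components in all the charts at [x],
   related by the Jacobians of the transition maps; the components are set to 0
   in the charts that are not defined at [x], so that equal tangent vectors are
   equal in the sense of Leibniz. *)
Record tangent (R : realType) (n : nat) (M : smoothAtlas R n) (x : M) :=
    Tangent {
  comp_in : idx M -> 'rV[R]_n;
  comp_out : forall a, ~ chart_dom a x -> comp_in a = 0;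
  comp_change : forall a b, chart_dom a x -> chart_dom b x ->
    comp_in b = 'D_(comp_in a) (transition a b) (chart a x)
}.

Section TangentSpace.
Context {R : realType} {n : nat} {M : smoothAtlas R n}.
Implicit Types (a b c : idx M) (x : M).

Lemma tangent_eq x (u v : tangent x) : comp_in u = comp_in v -> u = v.
Proof.
case: u v => [u u0 uc] [v v0 vc] /= uv; case: v / uv v0 vc => v0 vc.
by rewrite (Prop_irrelevance u0 v0) (Prop_irrelevance uc vc).
Qed.

Lemma tangent_ext x (u v : tangent x) :
  (forall a, chart_dom a x -> comp_in u a = comp_in v a) -> u = v.
Proof.
move=> uv; apply: tangent_eq; apply/funext => a.
have [ax|ax] := pselect (chart_dom a x); first exact: uv.
by rewrite !comp_out.
Qed.

Lemma transition_diff a b x : chart_dom a x -> chart_dom b x ->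
  differentiable (transition a b) (chart a x).
Proof.
move=> ax bx; apply: smooth_differentiable (transition_smooth M a b) _.
by exists x.
Qed.

Lemma derive_transitionD a b x u v : chart_dom a x -> chart_dom b x ->
  'D_(u + v) (transition a b) (chart a x) =
  'D_u (transition a b) (chart a x) + 'D_v (transition a b) (chart a x).
Proof. by move=> ax bx; rewrite !(deriveE _ (transition_diff ax bx)) linearD. Qed.

Lemma derive_transitionZ a b x k v : chart_dom a x -> chart_dom b x ->
  'D_(k *: v) (transition a b) (chart a x) =
  k *: 'D_v (transition a b) (chart a x).
Proof. by move=> ax bx; rewrite !(deriveE _ (transition_diff ax bx)) linearZ. Qed.

Lemma derive_transitionK a x v : chart_dom a x ->
  'D_v (transition a a) (chart a x) = v.
Proof.
move=> ax; rewrite -[RHS](derive_id (chart a x)); apply: near_eq_derive.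
have Ux : chart_range a (chart a x) by exists x.
by apply: (nbhs_open (chart_range_open a) Ux) => y /chart_rangeK[].
Qed.

Lemma transition_comp a b c y : overlap a b y ->
  transition b c (transition a b y) = transition a c y.
Proof.
by move=> /overlapP[/chart_rangeK[ay _] by_]; rewrite /transition /= chartK.
Qed.

Lemma derive_transition_comp a b c x v :
  chart_dom a x -> chart_dom b x -> chart_dom c x ->
  'D_('D_v (transition a b) (chart a x)) (transition b c) (chart b x) =
  'D_v (transition a c) (chart a x).
Proof.
move=> ax bx cx.
have E : transition a b (chart a x) = chart b x by rewrite /transition /= chartK.
have dbc := transition_diff bx cx; rewrite -E in dbc.
rewrite -{1}E -(derive_comp _ (transition_diff ax bx) dbc).
have Ux : overlap a b (chart a x) by exists x.
apply: near_eq_derive; apply: (nbhs_open (overlap_open M a b) Ux) => y.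
exact: transition_comp.
Qed.

Lemma tangent0_change x a b : chart_dom a x -> chart_dom b x ->
  (0 : 'rV[R]_n) = 'D_0 (transition a b) (chart a x).
Proof. by move=> _ _; rewrite derive0. Qed.

Definition tangent0 x : tangent x :=
  @Tangent R n M x (fun=> 0) (fun _ _ => erefl) (@tangent0_change x).

Lemma tangentD_subproof x (u v : tangent x) :
  (forall a, ~ chart_dom a x -> comp_in u a + comp_in v a = 0) /\
  (forall a b, chart_dom a x -> chart_dom b x -> comp_in u b + comp_in v b =
    'D_(comp_in u a + comp_in v a) (transition a b) (chart a x)).
Proof.
split=> [a ax|a b ax bx]; first by rewrite !comp_out// addr0.
by rewrite derive_transitionD// -!comp_change.
Qed.

Definition tangentD x (u v : tangent x) : tangent x :=
  Tangent (tangentD_subproof u v).1 (tangentD_subproof u v).2.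

Lemma tangentZ_subproof x (k : R) (u : tangent x) :
  (forall a, ~ chart_dom a x -> k *: comp_in u a = 0) /\
  (forall a b, chart_dom a x -> chart_dom b x -> k *: comp_in u b =
    'D_(k *: comp_in u a) (transition a b) (chart a x)).
Proof.
split=> [a ax|a b ax bx]; first by rewrite comp_out// scaler0.
by rewrite derive_transitionZ// -comp_change.
Qed.

Definition tangentZ x (k : R) (u : tangent x) : tangent x :=
  Tangent (tangentZ_subproof k u).1 (tangentZ_subproof k u).2.

Definition tangentN x (u : tangent x) : tangent x := tangentZ (-1) u.

Lemma tangent_addA x : associative (@tangentD x).
Proof. by move=> u v w; apply: tangent_eq; apply/funext => a; exact: addrA. Qed.

Lemma tangent_addC x : commutative (@tangentD x).
Proof. by move=> u v; apply: tangent_eq; apply/funext => a; exact: addrC. Qed.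

Lemma tangent_add0 x : left_id (tangent0 x) (@tangentD x).
Proof. by move=> u; apply: tangent_eq; apply/funext => a; exact: add0r. Qed.

Lemma tangent_addN x : left_inverse (tangent0 x) (@tangentN x) (@tangentD x).
Proof.
by move=> u; apply: tangent_eq; apply/funext => a /=; rewrite scaleN1r addNr.
Qed.

Lemma tangent_scaleA x (k l : R) (u : tangent x) :
  tangentZ k (tangentZ l u) = tangentZ (k * l) u.
Proof. by apply: tangent_eq; apply/funext => a; exact: scalerA. Qed.

Lemma tangent_scale1 x : left_id 1 (@tangentZ x).
Proof. by move=> u; apply: tangent_eq; apply/funext => a; exact: scale1r. Qed.

Lemma tangent_scaleDr x : right_distributive (@tangentZ x) (@tangentD x).
Proof. by move=> k u v; apply: tangent_eq; apply/funext => a; exact: scalerDr. Qed.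

Lemma tangent_scaleDl x (u : tangent x) :
  {morph (@tangentZ x)^~ u : k l / k + l >-> tangentD k l}.
Proof. by move=> k l; apply: tangent_eq; apply/funext => a; exact: scalerDl. Qed.

End TangentSpace.

HB.instance Definition _ R n (M : smoothAtlas R n) (x : M) :=
  gen_eqMixin (tangent x).
HB.instance Definition _ R n (M : smoothAtlas R n) (x : M) :=
  gen_choiceMixin (tangent x).
HB.instance Definition _ R n (M : smoothAtlas R n) (x : M) :=
  GRing.isZmodule.Build (tangent x) (@tangent_addA R n M x)
    (@tangent_addC R n M x) (@tangent_add0 R n M x) (@tangent_addN R n M x).
HB.instance Definition _ R n (M : smoothAtlas R n) (x : M) :=
  GRing.Zmodule_isLmodule.Build R (tangent x) (@tangent_scaleA R n M x)
    (@tangent_scale1 R n M x) (@tangent_scaleDr R n M x)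
    (@tangent_scaleDl R n M x).

Section TangentVectors.
Context {R : realType} {n : nat} {M : smoothAtlas R n}.
Implicit Types (a b c : idx M) (x : M).

(* The tangent vector at [x] with components [w] in the chart [a]. *)
Definition tangent_of_comp a x (w : 'rV[R]_n) (b : idx M) : 'rV[R]_n :=
  if `[< chart_dom a x /\ chart_dom b x >] then
    'D_w (transition a b) (chart a x) else 0.

Lemma tangent_of_subproof a x w :
  (forall b, ~ chart_dom b x -> tangent_of_comp a x w b = 0) /\
  (forall b c, chart_dom b x -> chart_dom c x -> tangent_of_comp a x w c =
    'D_(tangent_of_comp a x w b) (transition b c) (chart b x)).
Proof.
rewrite /tangent_of_comp; split=> [b bx|b c bx cx].
  by case: asboolP => // -[].
case: asboolP => [[ax _]|nax]; case: asboolP => [[ax' _]|nbx].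
- by rewrite derive_transition_comp.
- by case: nbx.
- by case: nax.
- by rewrite derive0.
Qed.

Definition tangent_of a x w : tangent x :=
  Tangent (tangent_of_subproof a x w).1 (tangent_of_subproof a x w).2.

Lemma comp_tangent_of a x w : chart_dom a x -> comp_in (tangent_of a x w) a = w.
Proof.
by move=> ax /=; rewrite /tangent_of_comp asboolT// derive_transitionK.
Qed.

Lemma tangent_ofE a x w b : chart_dom a x -> chart_dom b x ->
  comp_in (tangent_of a x w) b = 'D_w (transition a b) (chart a x).
Proof. by move=> ax bx /=; rewrite /tangent_of_comp asboolT. Qed.

Lemma tangent_ofK a x (v : tangent x) : chart_dom a x ->
  tangent_of a x (comp_in v a) = v.
Proof.
by move=> ax; apply: tangent_ext => b bx; rewrite tangent_ofE// -comp_change.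
Qed.

Lemma tangent_of_is_linear a x : linear (tangent_of a x).
Proof.
move=> k u v; apply: tangent_ext => b bx.
have [ax|nax] := pselect (chart_dom a x).
  transitivity (k *: comp_in (tangent_of a x u) b + comp_in (tangent_of a x v) b);
    last by [].
  by rewrite !tangent_ofE// derive_transitionD// derive_transitionZ.
transitivity (k *: comp_in (tangent_of a x u) b + comp_in (tangent_of a x v) b);
  last by [].
by rewrite /= /tangent_of_comp asboolF ?scaler0 ?addr0//; case.
Qed.

HB.instance Definition _ a x :=
  GRing.isLinear.Build R 'rV[R]_n (tangent x) *:%R (tangent_of a x)
    (tangent_of_is_linear a x).

End TangentVectors.

(** The k-cotangent bundle *)

Definition cotangent (R : realType) (n : nat) (M : smoothAtlas R n) (x : M) :=
  {scalar tangent x}.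

Section Cotangent.
Context {R : realType} {n : nat} {M : smoothAtlas R n}.

Lemma cotangent_eq (x : M) (p q : cotangent x) : p =1 q -> p = q.
Proof.
move=> /funext; case: p q => [p [[p1] [p2]]] [q [[q1] [q2]]] /= pq.
case: q / pq q1 q2 => q1 q2.
by rewrite (Prop_irrelevance p1 q1) (Prop_irrelevance p2 q2).
Qed.

Lemma covec_of_is_scalar (x : M) a (c : 'rV[R]_n) :
  scalar (fun v : tangent x => \sum_i c 0 i * comp_in v a 0 i).
Proof.
move=> k u v; rewrite mulr_sumr -big_split /=; apply: eq_bigr => i _.
by rewrite !mxE mulrDr mulrCA.
Qed.

(* The covector [\sum_i c_i dx^i] at [x], for the coordinates [x^i] of the
   chart [a]. *)
Definition covec_of a (x : M) (c : 'rV[R]_n) : cotangent x :=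
  HB.pack (fun v : tangent x => \sum_i c 0 i * comp_in v a 0 i)
    (GRing.isLinear.Build R (tangent x) R *%R _ (covec_of_is_scalar a c)).

End Cotangent.

(* A point of the bundle is a point [x] of [M] with [k] covectors at [x]. *)
Definition kcovectors (R : realType) (n : nat) (M : smoothAtlas R n) (k : nat) :=
  {x : M & 'I_k -> cotangent x}.

Section KCotangentCharts.
Context {R : realType} {n : nat} {M : smoothAtlas R n} {k : nat}.
Implicit Types (a b : idx M) (q : kcovectors M k).

Definition base q : M := projT1 q.
Definition covec q : 'I_k -> cotangent (base q) := projT2 q.

(* The components [p_i^A = p^A (d/dx^i)]. *)
Definition momenta a q : 'M[R]_(k, n) :=
  \matrix_(A, i) covec q A (tangent_of a (base q) 'e_i).

Definition kchart a q : 'rV[R]_(n + k * n) :=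
  row_mx (chart a (base q)) (mxvec (momenta a q)).

Definition kinv a (z : 'rV[R]_(n + k * n)) : kcovectors M k :=
  existT (fun x : M => 'I_k -> cotangent x) (chart_inv a (lsubmx z))
    (fun A => covec_of a _ (row A (vec_mx (rsubmx z)))).

Definition kdom a : set (kcovectors M k) := base @^-1` chart_dom a.

Lemma momentaK a (x : M) (p : 'I_k -> cotangent x) : chart_dom a x ->
  (fun A => covec_of a x (row A (momenta a (existT _ x p)))) = p.
Proof.
move=> ax; apply/funext => A; apply: cotangent_eq => v /=.
rewrite -[in RHS](tangent_ofK v ax) [in RHS](row_sum_delta (comp_in v a)).
rewrite !linear_sum; apply: eq_bigr => i _.
by rewrite !mxE !linearZ /= mulrC.
Qed.

Lemma kchartK a q : kdom a q -> kinv a (kchart a q) = q.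
Proof.
case: q => x p ax; rewrite /kinv /kchart row_mxKl row_mxKr mxvecK.
have := chartK _ (ax : chart_dom a x); rewrite /base /= => ->.
by rewrite momentaK.
Qed.

Lemma kcover q : exists a, kdom a q.
Proof. exact: (atlas_cover (base q)). Qed.

Lemma momenta_kinv a b z :
  chart_range a (lsubmx z) -> chart_dom b (chart_inv a (lsubmx z)) ->
  momenta b (kinv a z) = \matrix_(A, i) \sum_j
    vec_mx (rsubmx z) A j *
    ('D_('e_i) (transition b a) (transition a b (lsubmx z))) 0 j.
Proof.
move=> /chart_rangeK[az zE] bz; apply/matrixP => A i; rewrite !mxE /=.
apply: eq_bigr => j _; congr (_ * _); first by rewrite mxE.
exact: (congr1 (fun w : 'rV[R]_n => w 0 j) (tangent_ofE 'e_i bz az)).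
Qed.

Lemma koverlapE a b :
  kchart a @` (kdom a `&` kdom b) = lsubmx @^-1` overlap a b.
Proof.
apply/seteqP; split=> [_ [q [aq bq] <-]|z /= /overlapP[raz bz]].
  by rewrite /kchart /= row_mxKl; exists (base q).
have [az zE] := chart_rangeK raz.
exists (kinv a z); first by [].
rewrite /kchart /= zE momenta_kinv//.
rewrite -[RHS](hsubmxK z); congr row_mx.
rewrite -[RHS]vec_mxK; congr mxvec; apply/matrixP => A i.
rewrite mxE (bigD1 i)//= big1 ?addr0.
  by rewrite -zE /transition /= chartK// derive_transitionK// !mxE !eqxx mulr1.
move=> j ji; rewrite -zE /transition /= chartK// derive_transitionK//.
by rewrite !mxE (negbTE ji) mulr0.
Qed.

Lemma koverlap_open a b : open (kchart a @` (kdom a `&` kdom b)).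
Proof.
rewrite koverlapE; apply: open_comp; last exact: overlap_open.
move=> z _; apply: differentiable_continuous; exact: differentiable_lsubmx.
Qed.

Lemma ktransition_smooth a b :
  smooth_on (kchart a @` (kdom a `&` kdom b)) (kchart b \o kinv a).
Proof.
have oU := @koverlap_open a b.
set U := kchart a @` _ in oU *.
have Ul : forall z, U z -> overlap a b (lsubmx z) by move=> z; rewrite /U koverlapE.
have sl : smooth_on U (@lsubmx R 1 n (k * n)).
  apply: smooth_row => // j l.
  apply: (@eq_Ck _ _ _ oU _ l (fun z => z 0 (lshift (k * n) j))).
    by move=> z _; rewrite !mxE.
  exact: Ck_coord.
have st : smooth_on U (transition a b \o lsubmx).
  apply: smooth_comp => //; [exact: (overlap_open M a b)|exact: Ul|].
  exact: (transition_smooth M a b).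
apply: (@eq_smooth _ _ _ oU _ (fun z => row_mx (transition a b (lsubmx z))
    (mxvec (\matrix_(A, i) \sum_j vec_mx (rsubmx z) A j *
      ('D_('e_i) (transition b a) (transition a b (lsubmx z))) 0 j)))).
  move=> z /Ul /overlapP[rz bz].
  by rewrite /= /kchart momenta_kinv.
apply: smooth_row => // j l; case: (split_ordP j) => [i ->|i ->].
  apply: (@eq_Ck _ _ _ oU _ l (fun z => (transition a b (lsubmx z)) 0 i)).
    by move=> z _; rewrite row_mxEl.
  exact: (@Ck_coord_comp _ _ _ oU _ _ (transition a b \o lsubmx)).
case/mxvec_indexP: i => A i.
apply: (@eq_Ck _ _ _ oU _ l (fun z => \sum_j vec_mx (rsubmx z) A j *
      ('D_('e_i) (transition b a) (transition a b (lsubmx z))) 0 j)).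
  by move=> z _; rewrite row_mxEr mxvecE mxE.
apply: Ck_sum => // j'; apply: CkM => //.
  apply: (@eq_Ck _ _ _ oU _ l (fun z => z 0 (rshift n (mxvec_index A j')))).
    by move=> z _; rewrite !mxE.
  exact: Ck_coord.
pose T := fun y : 'rV[R]_n => 'D_('e_i) (transition b a) y.
apply: (@Ck_coord_comp _ _ _ oU _ _ (T \o (transition a b \o lsubmx))).
apply: smooth_comp oU (overlap_open M b a) _ _ st l.
  move=> z /Ul [x [ax bx] xE]; exists x => //.
  by rewrite /= -xE /transition /= chartK.
by apply: smooth_derive; exact: transition_smooth.
Qed.

End KCotangentCharts.

Definition kcotangent (R : realType) (n : nat) (M : smoothAtlas R n) (k : nat) :
    smoothAtlas R (n + k * n) :=
  @SmoothAtlas R (n + k * n) (kcovectors M k) (idx M) kdom kchart kinv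
    (@kchartK R n M k) (@kcover R n M k)
    (@koverlap_open R n M k) (@ktransition_smooth R n M k).

Definition cotangent_bundle (R : realType) (n : nat) (M : smoothAtlas R n) :=
  kcotangent M 1.

(* The projection on the [A]-th copy of the cotangent bundle. *)
Definition ktau (R : realType) (n : nat) (M : smoothAtlas R n) (k : nat)
    (A : 'I_k) (q : kcotangent M k) : cotangent_bundle M :=
  existT (fun x : M => 'I_1 -> cotangent x) (base q) (fun=> covec q A).

(** Differential calculus on manifolds *)

Section Calculus.
Context {R : realType} {n : nat} {M : smoothAtlas R n}.

Definition smooth_fun (V : normedModType R) (f : M -> V) : Prop :=
  forall a, smooth_on (chart_range a) (f \o chart_inv a).

(* The components of [X] in the chart [a], as a function of the coordinates. *)
Definition local_comp (X : forall x : M, tangent x) (a : idx M)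
    (y : 'rV[R]_n) : 'rV[R]_n :=
  comp_in (X (chart_inv a y)) a.

Record vectorField := VectorField {
  vfield :> forall x : M, tangent x;
  vfield_smooth : forall a, smooth_on (chart_range a) (local_comp vfield a)
}.

(* Pointwise operations are computed in a chosen chart around the point; for
   smooth arguments their values do not depend on the choice. *)
Definition chart_at (x : M) : idx M := projT1 (cid (atlas_cover x)).

Lemma chart_atP (x : M) : chart_dom (chart_at x) x.
Proof. exact: projT2 (cid (atlas_cover x)). Qed.

(* Differential forms are functions on tangent vectors; multilinearity and
   smoothness are not part of the types. *)
Definition form1 : Type := forall x : M, tangent x -> R.
Definition form2 : Type := forall x : M, tangent x -> tangent x -> R.

Definition differential (f : M -> R) : form1 := fun x v =>
  let a := chart_at x in
  'D_(comp_in v a) (f \o chart_inv a) (chart a x).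

Definition interior (X : vectorField) (w : form2) : form1 :=
  fun x v => w x (X x) v.

(* [(d t)_ij = d_i t_j - d_j t_i], i.e.
   [d t (U, V) = U (t V) - V (t U) - t [U, V]] for vector fields [U], [V] with
   constant components in the chart. *)
Definition ext_d (t : form1) : form2 := fun x u v =>
  let a := chart_at x in
  let loc w y := t (chart_inv a y) (tangent_of a (chart_inv a y) w) in
  'D_(comp_in u a) (loc (comp_in v a)) (chart a x) -
  'D_(comp_in v a) (loc (comp_in u a)) (chart a x).

Definition lie_fun (X : vectorField) (f : M -> R) : M -> R :=
  fun x => differential f (X x).

(* [[X, Y]^i = X^j d_j Y^i - Y^j d_j X^i] *)
Definition lie_vf (X Y : vectorField) : forall x : M, tangent x := fun x =>
  let a := chart_at x in
  tangent_of a x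
    ('D_(comp_in (X x) a) (local_comp Y a) (chart a x) -
     'D_(comp_in (Y x) a) (local_comp X a) (chart a x)).

(* [(L_X w)_ij = X^l d_l w_ij + w_lj d_i X^l + w_il d_j X^l] *)
Definition lie_form2 (X : vectorField) (w : form2) : form2 := fun x u v =>
  let a := chart_at x in
  let loc y := w (chart_inv a y) (tangent_of a (chart_inv a y) (comp_in u a))
                 (tangent_of a (chart_inv a y) (comp_in v a)) in
  'D_(comp_in (X x) a) loc (chart a x) +
  w x (tangent_of a x ('D_(comp_in u a) (local_comp X a) (chart a x))) v +
  w x u (tangent_of a x ('D_(comp_in v a) (local_comp X a) (chart a x))).

End Calculus.

Arguments vectorField {R n} M.
Arguments form1 {R n} M.
Arguments form2 {R n} M.

Section Maps.
Context {R : realType} {m n : nat} {M : smoothAtlas R m} {N : smoothAtlas R n}.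

Definition tangent_map (F : M -> N) (x : M) (v : tangent x) : tangent (F x) :=
  let a := chart_at x in
  let b := chart_at (F x) in
  tangent_of b (F x)
    ('D_(comp_in v a) (chart b \o F \o chart_inv a) (chart a x)).

Definition pullback (F : M -> N) (w : form2 N) : form2 M :=
  fun x u v => w (F x) (tangent_map F u) (tangent_map F v).

End Maps.

(** k-vector fields *)

Section KVectorFields.
Context {R : realType} {n : nat} {M : smoothAtlas R n} {k : nat}.

Definition kvectorField : Type := 'I_k -> vectorField M.

(* Smoothness of a map defined on the open set [U] of [R^k]. *)
Definition smooth_from (U : set 'rV[R]_k) (psi : 'rV[R]_k -> M) : Prop :=
  forall a, open (U `&` psi @^-1` chart_dom a) /\
            smooth_on (U `&` psi @^-1` chart_dom a) (chart a \o psi).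

Definition push_partial (psi : 'rV[R]_k -> M) (A : 'I_k) (t : 'rV[R]_k) :
    tangent (psi t) :=
  let a := chart_at (psi t) in
  tangent_of a (psi t) ('D_('e_A) (chart a \o psi) t).

Definition integral_section (X : kvectorField) (x : M) (U : set 'rV[R]_k)
    (psi : 'rV[R]_k -> M) : Prop :=
  [/\ open U, U 0, smooth_from U psi, psi 0 = x &
      forall t A, U t -> push_partial psi A t = X A (psi t)].

Definition integrable_kvf (X : kvectorField) : Prop :=
  forall x, exists U psi, integral_section X x U psi.

Definition conservation_law (X : kvectorField) (Phi : M -> 'rV[R]_k) : Prop :=
  smooth_fun Phi /\
  forall x, \sum_(A < k) lie_fun (X A) (fun y => Phi y 0 A) x = 0.

Definition is_symmetry (X : kvectorField) (Y : vectorField M) : Prop :=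
  forall A x, lie_vf (X A) Y x = 0.

Definition is_pseudosymmetry (Z X : kvectorField) (S : vectorField M) : Prop :=
  forall A, exists lambda : 'I_k -> M -> R,
    (forall B, smooth_fun (lambda B)) /\
    forall x, lie_vf (X A) S x = \sum_(B < k) lambda B x *: Z B x.

End KVectorFields.

Arguments kvectorField {R n} M k.

(** The canonical forms *)

Section CanonicalForms.
Context {R : realType} {n : nat} (M : smoothAtlas R n).

Definition cotangent_proj : cotangent_bundle M -> M := @base R n M 1.

Definition liouville : form1 (cotangent_bundle M) :=
  fun q v => covec q ord0 (tangent_map cotangent_proj v).

Definition canonical_symplectic : form2 (cotangent_bundle M) :=
  fun q u v => - ext_d liouville u v.

Definition omega0 (k : nat) (A : 'I_k) : form2 (kcotangent M k) :=
  pullback (ktau A) canonical_symplectic.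

Definition evolution_kvf (k : nat) (H : kcotangent M k -> R)
    (X : kvectorField (kcotangent M k) k) : Prop :=
  forall q (v : tangent q),
    \sum_(A < k) interior (X A) (omega0 A) v = differential H v.

End CanonicalForms.

Arguments liouville {R n} M [x] v : rename.
Arguments canonical_symplectic {R n} M [x] u v : rename.
Arguments omega0 {R n} M {k} A [x] u v : rename.
Arguments evolution_kvf {R n M k} H X.

Section LiouvilleInCoordinates.
Context {R : realType} {n : nat} (M : smoothAtlas R n).

Lemma lsub_diff k z : differentiable (lsubmx : 'rV[R]_(n + k) -> 'rV[R]_n) z.
Proof. exact: differentiable_lsubmx. Qed.

Lemma derive_lsub k z v :
  'D_v (lsubmx : 'rV[R]_(n + k) -> 'rV[R]_n) z = lsubmx v.
Proof.
apply/rowP => i; rewrite derive_mx; last exact: diff_derivable (lsub_diff z).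
rewrite !mxE.
have -> : (fun t : 'rV[R]_(n + k) => lsubmx t 0 i) = (fun t => t 0 (lshift k i)).
  by apply/funext => t; rewrite mxE.
have /(congr1 (fun A : 'rV[R]_(n + k) => A 0 (lshift k i))) :=
  derive_mx (@derivable_id _ _ z v).
by rewrite derive_id !mxE.
Qed.

Lemma derive_trans_lsub k (a b : idx M) z v : overlap a b (lsubmx z) ->
  'D_v (transition a b \o (lsubmx : 'rV[R]_(n + k) -> 'rV[R]_n)) z =
  'D_(lsubmx v) (transition a b) (lsubmx z).
Proof.
move=> [x [ax bx] xE].
rewrite derive_comp ?derive_lsub//; first exact: lsub_diff.
by rewrite -xE; exact: transition_diff.
Qed.

Lemma tangent_map_base k (q : kcotangent M k) a (w : 'rV[R]_(n + k * n)) :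
  chart_dom a q ->
  tangent_map (@base R n M k : kcotangent M k -> M) (tangent_of a q w) =
  tangent_of (a : idx M) (base q) (lsubmx w).
Proof.
move=> aq; have cq := chart_atP q; have cb := chart_atP (base q).
rewrite /tangent_map tangent_ofE//.
set c' := chart_at q in cq *; set c := chart_at (base q) in cb *.
have E : lsubmx (chart c' q) = chart (c' : idx M) (base q) by rewrite row_mxKl.
have Ea : lsubmx (chart a q) = chart (a : idx M) (base q) by rewrite row_mxKl.
have -> : chart c \o @base R n M k \o chart_inv c' =
    transition (c' : idx M) c \o lsubmx by [].
rewrite derive_trans_lsub ?E; last by exists (base q).
rewrite -[RHS](tangent_ofK _ cb); congr tangent_of.
rewrite tangent_ofE// -(@derive_transition_comp _ _ _ (a : idx M) (c' : idx M))//.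
congr ('D__ _ _).
rewrite -Ea -derive_trans_lsub; last by rewrite Ea; exists (base q).
have -> : lsubmx ('D_w (transition a c') (chart a q)) =
    'D_('D_w (transition a c') (chart a q))
      (lsubmx : 'rV[R]_(n + k * n) -> 'rV[R]_n) (transition a c' (chart a q)).
  by rewrite derive_lsub.
rewrite -derive_comp; last 2 first.
  exact: (@transition_diff _ _ (kcotangent M k) a c' q).
  exact: lsub_diff.
apply: near_eq_derive.
have Uq : overlap a c' (chart a q) by exists q.
apply: (nbhs_open (overlap_open (kcotangent M k) a c') Uq) => z _ /=.
exact: row_mxKl.
Qed.

(* [theta = \sum_i p_i dx^i] in the natural coordinates. *)
Lemma liouvilleE (q : cotangent_bundle M) (a : idx M) w : kdom a q ->
  liouville M (tangent_of (a : idx (cotangent_bundle M)) q w) =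
  \sum_i momenta a q 0 i * lsubmx w 0 i.
Proof.
move=> aq; rewrite /liouville tangent_map_base//.
rewrite [lsubmx w in LHS]row_sum_delta !linear_sum /=.
by apply: eq_bigr => i _; rewrite !linearZ /= mulrC; congr (_ * _); rewrite mxE.
Qed.
End LiouvilleInCoordinates.

(* Main.v *)
From HB Require Import structures.
Require Import Defs.
From mathcomp Require Import all_boot all_order all_algebra.
From mathcomp Require Import all_classical all_reals all_analysis.
From mathcomp Require Import ring lra.
Import Order.TTheory GRing.Theory Num.Theory.
Import numFieldNormedType.Exports.

Set Implicit Arguments.
Unset Strict Implicit.
Unset Printing Implicit Defensive.

Local Open Scope classical_set_scope.
Local Open Scope ring_scope.

(** Why the theorem holds.  The Lie derivative is a derivation with respect to
    every contraction, so for vector fields [X], [S], [Y] and the 2-form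
    [omega_A],
      [X (omega_A (S, Y)) = (L_X omega_A) (S, Y) + omega_A ([X, S], Y)
                            + omega_A (S, [X, Y])]
    (lemma [lie_fun_omega0]).  For [X = X_A] the first term vanishes because
    [X_A] preserves [omega_A], and the third because [Y] is a symmetry.  If [S]
    is a pseudosymmetry with respect to [(Y, ..., Y)], then [[X_A, S]] is a
    function times [Y], so the second term vanishes because [omega_A] is
    alternating.  Hence every [L_{X_A} Phi_A] is zero, and not only their sum.
    A symmetry is a pseudosymmetry with zero coefficients.

    The Leibniz rule is a computation in a chart, once [omega_A] is known to be
    [\sum_i dx^i /\ dp_i^A] in the natural coordinates of every chart (lemma
    [omega0E]): the coefficients are then constant, and both the smoothness of
    [omega_A (S, Y)] and its derivative are read off the components of the
    fields.  The difficulty is that [ext_d] and [tangent_map] are computed in a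
    chart chosen separately at each point, so that nothing can be differentiated
    before independence of the chart is proved.  For the exterior derivative of
    a 1-form this rests on the symmetry of the second derivatives of the
    transition maps ([derive_derive_sym], [ext_d_in_chart]); for the tangent map
    it is the chain rule ([tangent_map_in_charts]). *)

(** * Symmetry of second derivatives *)

Section SymmetryOfSecondDerivatives.
Context {R : realType} {V : normedModType R}.
Implicit Types (f : V -> R) (x u v z : V).

Definition second_difference f x u v (t : R) : R :=
  (f (t *: u + (t *: v + x)) - f (t *: u + x)) - (f (t *: v + x) - f x).

Lemma second_differenceC f x u v t :
  second_difference f x u v t = second_difference f x v u t.
Proof. by rewrite /second_difference addrCA; ring. Qed.

Lemma is_derive_line f z u (s : R) : derivable f (s *: u + z) u ->
  is_derive s (1 : R) (fun r => f (r *: u + z)) ('D_u f (s *: u + z)).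
Proof.
have E : (fun h : R => h^-1 *: (f ((h *: 1 + s) *: u + z) - f (s *: u + z))) =
         (fun h : R => h^-1 *: (f (h *: u + (s *: u + z)) - f (s *: u + z))).
  by apply/funext => h; rewrite [h *: 1]mulr1 scalerDl addrA.
move=> df; split; first by rewrite /derivable /= E.
by rewrite /derive /= E.
Qed.

(** The mean value theorem in the direction [u], applied to
    [f (. + t v) - f], produces [t] times an increment of ['D_u f], which the
    differentiability of ['D_u f] at [x] evaluates up to [o(t)]. *)
Lemma second_difference_equiv f x u v :
  (\forall y \near x, differentiable f y) -> differentiable ('D_u f) x ->
  forall e : R, 0 < e -> \forall t \near 0^'+,
    `|second_difference f x u v t - t ^+ 2 * 'D_v ('D_u f) x| <= e * t ^+ 2.
Proof.
move=> df dg e e0.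
pose K : R := `|u| + `|v| + 1.
have K0 : 0 < K by rewrite ltr_wpDl// addr_ge0.
(* Two increments of size at most [t * K] are estimated, each contributing
   [e' * (t * K)]; this choice of [e'] makes the total [e * t]. *)
pose e' := e / (2 * K).
have e'0 : 0 < e' by rewrite divr_gt0// mulr_gt0.
have [_ /eqaddoP/(_ e' e'0)] := (diff_locallyP _ _).1 dg.
move: df => /nbhs_ballP[d1 /= d10 df] /nbhs_ballP[d2 /= d20 Dg].
have {}df h : `|h| < d1 -> differentiable f (h + x).
  by move=> hd; apply: df; rewrite -ball_normE /= opprD addrCA subrr addr0 normrN.
have {}Dg h : `|h| < d2 ->
    `|'D_u f (h + x) - 'D_u f x - 'd ('D_u f) x h| <= e' * `|h|.
  move=> hd; have := Dg h; rewrite -ball_normE /= sub0r normrN => /(_ hd).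
  by rewrite !fctE /= opprD addrA.
near=> t.
have t0 : 0 < t by near: t; exact: nbhs_right_gt.
have tK1 : t * K < d1.
  by rewrite -ltr_pdivlMr//; near: t; apply: nbhs_right_lt; rewrite divr_gt0.
have tK2 : t * K < d2.
  by rewrite -ltr_pdivlMr//; near: t; apply: nbhs_right_lt; rewrite divr_gt0.
have su s : s \in `[0, t]%R -> `|s *: u| <= t * K.
  rewrite in_itv /= => /andP[s0 st]; rewrite normrZ ger0_norm//.
  by apply: ler_pM => //; rewrite /K -addrA lerDl addr_ge0.
have suv s : s \in `[0, t]%R -> `|s *: u + t *: v| <= t * K.
  rewrite in_itv /= => /andP[s0 st]; apply: le_trans (ler_normD _ _) _.
  rewrite !normrZ (ger0_norm s0) (gtr0_norm t0).
  have : s * `|u| <= t * `|u| by apply: ler_wpM2r.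
  by rewrite /K !mulrDr mulr1; lra.
pose phi (s : R) := f (s *: u + (t *: v + x)) - f (s *: u + x).
pose dphi (s : R) := 'D_u f (s *: u + (t *: v + x)) - 'D_u f (s *: u + x).
have phiD s : s \in `[0, t]%R -> is_derive s (1 : R) phi (dphi s).
  move=> st; apply: is_deriveB; apply: is_derive_line; apply: diff_derivable.
    by rewrite addrA; apply: df; exact: le_lt_trans (suv _ st) tK1.
  by apply: df; exact: le_lt_trans (su _ st) tK1.
have phi_cont : {within `[0, t], continuous phi}.
  by apply: derivable_within_continuous => s /phiD[].
have phiD' s : s \in `]0, t[%R -> is_derive s (1 : R) phi (dphi s).
  by move=> st; apply: phiD; exact: subset_itv_oo_cc st.
have [s st] := MVT t0 phiD' phi_cont.
have {}st : s \in `[0, t]%R by exact: subset_itv_oo_cc st.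
have -> : phi t - phi 0 = second_difference f x u v t.
  by rewrite /phi /second_difference !scale0r !add0r.
rewrite subr0 => ->.
have h1 := Dg _ (le_lt_trans (suv _ st) tK2).
have h2 := Dg _ (le_lt_trans (su _ st) tK2).
have {h1} := le_trans h1 (ler_wpM2l (ltW e'0) (suv _ st)).
have {h2} := le_trans h2 (ler_wpM2l (ltW e'0) (su _ st)).
have dZ (r : R) w : 'd ('D_u f) x (r *: w) = r * 'D_w ('D_u f) x.
  by rewrite linearZ deriveE.
rewrite linearD !dZ /dphi addrA.
set a := 'D_u f (_ + x); set b := 'D_u f (_ + x); set c := 'D_u f x.
set l := s * _; set m := 'D_v _ x => ha hb.
have -> : e * t ^+ 2 = (e' * (t * K) + e' * (t * K)) * t.
  rewrite /e'; field; exact: lt0r_neq0.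
have -> : (b - a) * t - t ^+ 2 * m = ((b - c - (l + t * m)) - (a - c - l)) * t.
  by ring.
rewrite normrM (gtr0_norm t0) ler_pM2r//.
by rewrite (le_trans (ler_normB _ _))// lerD.
Unshelve. all: by end_near. Qed.

(** Both iterated derivatives are limits of the same second difference, which is
    symmetric in [u] and [v], divided by [t ^+ 2]. *)
Lemma derive_derive_sym f x u v :
  (\forall y \near x, differentiable f y) ->
  differentiable ('D_u f) x -> differentiable ('D_v f) x ->
  'D_v ('D_u f) x = 'D_u ('D_v f) x.
Proof.
move=> df du dv; apply/eqP; rewrite -subr_eq0 -normr_le0.
apply/ler_addgt0Pr => e e0; rewrite add0r.
have e2 : 0 < e / 2 by rewrite divr_gt0.
have huv := second_difference_equiv v df du e2.
have hvu := second_difference_equiv u df dv e2.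
have [t [/= t0 [+ +]]] := filter_ex (filterI (nbhs_right_gt 0) (filterI huv hvu)).
rewrite second_differenceC.
move: (second_difference _ _ _ _ _) ('D_v ('D_u f) x) ('D_u ('D_v f) x) => D p q.
move=> Duv Dvu; have t2 : 0 < t ^+ 2 by rewrite exprn_gt0.
rewrite -(ler_pM2r t2) -{1}(gtr0_norm t2) -normrM.
have -> : (p - q) * t ^+ 2 = (D - t ^+ 2 * q) - (D - t ^+ 2 * p) by ring.
have -> : e * t ^+ 2 = e / 2 * t ^+ 2 + e / 2 * t ^+ 2 by field.
by rewrite (le_trans (ler_normB _ _))// lerD.
Qed.

End SymmetryOfSecondDerivatives.

(** * Calculus with coordinates *)

Section CoordinateCalculus.
Context {R : realType}.

Lemma derive_row (V : normedModType R) n (f : V -> 'rV[R]_n) x v i :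
  differentiable f x -> 'D_v f x 0 i = 'D_v (fun y => f y 0 i) x.
Proof. by move=> df; rewrite derive_mx ?mxE//; exact: diff_derivable. Qed.

Lemma differentiable_row_coord (V : normedModType R) n (f : V -> 'rV[R]_n) x i :
  differentiable f x -> differentiable (fun y => f y 0 i) x.
Proof.
move=> df; apply: (differentiable_comp (g := fun y : 'rV[R]_n => y 0 i)) => //.
exact: differentiable_coord.
Qed.

Lemma is_derive_dot (V : normedModType R) n (f g : V -> 'rV[R]_n) x v :
  differentiable f x -> differentiable g x ->
  is_derive x v (fun y => \sum_i f y 0 i * g y 0 i)
    (\sum_i ('D_v f x 0 i * g x 0 i + f x 0 i * 'D_v g x 0 i)).
Proof.
move=> df dg.
have D (h : V -> 'rV[R]_n) i : differentiable h x ->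
    is_derive x v (fun y => h y 0 i) ('D_v h x 0 i : R).
  move=> dh; rewrite derive_row//; apply: derivableP; apply: diff_derivable.
  exact: differentiable_row_coord.
have -> : (fun y => \sum_i f y 0 i * g y 0 i) =
    \sum_i (fun y => f y 0 i) * (fun y => g y 0 i).
  by apply/funext => y; rewrite fct_sumE.
apply: is_derive_sum => i.
apply: is_derive_eq (is_deriveM (D f i df) (D g i dg)) _.
by rewrite addrC; congr (_ + _); exact: mulrC.
Qed.

Lemma smooth_derive_dir m n (U : set 'rV[R]_m) (f : 'rV[R]_m -> 'rV[R]_n) w :
  open U -> smooth_on U f -> smooth_on U ('D_w f).
Proof.
move=> oU sf; apply: smooth_row => // i k.
apply: (@eq_Ck _ _ _ oU _ k (fun x => \sum_j w 0 j * ('D_('e_j) f x) 0 i)).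
  move=> x Ux; rewrite [in RHS]derive_sum_coord.
    by rewrite summxE; apply: eq_bigr => j _; rewrite mxE.
  exact: smooth_differentiable sf Ux.
apply: Ck_sum => // j; apply: CkM => //; first exact: Ck_cst.
by apply: (@Ck_coord_comp _ _ _ oU _ _ ('D_('e_j) f)); exact: smooth_derive.
Qed.

Lemma smooth_derive_sym m n (U : set 'rV[R]_m) (f : 'rV[R]_m -> 'rV[R]_n) x u v :
  open U -> smooth_on U f -> U x -> 'D_v ('D_u f) x = 'D_u ('D_v f) x.
Proof.
move=> oU sf Ux; apply/rowP => i.
have df y : U y -> differentiable f y by move=> Uy; exact: smooth_differentiable sf Uy.
have ddf w : differentiable ('D_w f) x.
  by apply: smooth_differentiable Ux; exact: smooth_derive_dir.
have E w : \near x, 'D_w f x 0 i = 'D_w (fun y => f y 0 i) x.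
  by apply: (nbhs_open oU Ux) => y /df dy; exact: derive_row.
have ddfi w : differentiable ('D_w (fun y => f y 0 i)) x.
  by apply: near_eq_differentiable (E w) _; exact: differentiable_row_coord.
have {}E w w' :
    'D_w' ('D_w f) x 0 i = 'D_w' ('D_w (fun y => f y 0 i)) x.
  by apply: etrans (derive_row w' i (ddf w)) _; exact: near_eq_derive (E w).
apply: etrans (E u v) (etrans _ (esym (E v u))).
apply: derive_derive_sym; [|exact: ddfi|exact: ddfi].
by apply: (nbhs_open oU Ux) => y /df dy; exact: differentiable_row_coord.
Qed.

End CoordinateCalculus.

(** * The exterior derivative in an arbitrary chart *)

Section ExteriorDerivative.
Context {R : realType} {m : nat} {N : smoothAtlas R m}.

Lemma tangent_of_transition (a c : idx N) x w : chart_dom a x -> chart_dom c x ->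
  tangent_of c x ('D_w (transition a c) (chart a x)) = tangent_of a x w.
Proof. by move=> ax cx; rewrite -(tangent_ofE w ax cx) tangent_ofK. Qed.

Lemma transitionE (a c : idx N) x : chart_dom a x ->
  transition a c (chart a x) = chart c x.
Proof. by move=> ax; rewrite /transition /= chartK. Qed.

(** With [T] the transition map from the chart [a] chosen by [ext_d] to [c], the
    1-form reads [P (T y) . 'D_w T y] in [a].  Differentiating along [w'] and
    antisymmetrizing in [w] and [w'] leaves the derivatives of [P] composed with
    [T], which are the expression in [c]; the remaining terms contain
    ['D_w' ('D_w T)] and cancel by symmetry. *)
Lemma ext_d_in_chart (t : form1 N) (P : 'rV[R]_m -> 'rV[R]_m) (c : idx N) x
    (u v : tangent x) :
  chart_dom c x ->
  (forall y w, chart_range c y ->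
     t (chart_inv c y) (tangent_of c (chart_inv c y) w) =
     \sum_i P y 0 i * w 0 i) ->
  differentiable P (chart c x) ->
  ext_d t u v =
  \sum_i ('D_(comp_in u c) P (chart c x) 0 i * comp_in v c 0 i -
          'D_(comp_in v c) P (chart c x) 0 i * comp_in u c 0 i).
Proof.
move=> cx tP dP; rewrite /ext_d; have := chart_atP x.
set a := chart_at x => ax.
pose T := transition a c.
have oU : open (overlap a c) := overlap_open N a c.
have Ux : overlap a c (chart a x) by exists x.
have sT : smooth_on (overlap a c) T := transition_smooth N a c.
have dT : differentiable T (chart a x) := transition_diff ax cx.
have Tx : T (chart a x) = chart c x by exact: transitionE.
have dPT : differentiable (P \o T) (chart a x).
  by apply: differentiable_comp => //; rewrite Tx.
have dDT w : differentiable ('D_w T) (chart a x).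
  by apply: smooth_differentiable Ux; exact: smooth_derive_dir.
have locE w : \forall y \near chart a x,
    t (chart_inv a y) (tangent_of a (chart_inv a y) w) =
    \sum_i (P \o T) y 0 i * 'D_w T y 0 i.
  apply: (nbhs_open oU Ux) => _ [z [az cz] <-].
  rewrite chartK// /= -tP; last by exists z => //; rewrite /T transitionE.
  by rewrite /T transitionE// chartK// tangent_of_transition.
have DlocE w w' : 'D_w' (fun y => t (chart_inv a y) (tangent_of a (chart_inv a y) w))
      (chart a x) =
    \sum_i ('D_('D_w' T (chart a x)) P (chart c x) 0 i * 'D_w T (chart a x) 0 i +
            P (chart c x) 0 i * 'D_w' ('D_w T) (chart a x) 0 i).
  rewrite (near_eq_derive _ (locE w)); have [_ ->] := is_derive_dot w' dPT (dDT w).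
  by rewrite derive_comp ?Tx//= Tx.
rewrite !DlocE -!comp_change// -sumrB; apply: eq_bigr => i _.
rewrite (smooth_derive_sym (comp_in u a) (comp_in v a) oU sT Ux).
by rewrite opprD addrACA subrr addr0.
Qed.

End ExteriorDerivative.

(** * Linear maps between spaces of row vectors *)

Section LinearMaps.
Context {R : realType} {m p : nat} (f : {linear 'rV[R]_m -> 'rV[R]_p}).

Lemma differentiable_linear_row x : differentiable f x.
Proof.
have -> : (f : 'rV[R]_m -> 'rV[R]_p) = \sum_j (fun y : 'rV[R]_m => y 0 j *: f 'e_j).
  apply/funext => y; rewrite fct_sumE [in LHS](row_sum_delta y) linear_sum.
  by apply: eq_bigr => j _; rewrite linearZ.
apply: differentiable_sum => j.
apply: differentiableZl.
exact: differentiable_coord.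
Qed.

Lemma derive_linear_row x w : 'D_w f x = f w.
Proof.
rewrite deriveE; last exact: differentiable_linear_row.
rewrite diff_lin// => y.
by apply: differentiable_continuous; exact: differentiable_linear_row.
Qed.

Lemma derive_linear_comp (V : normedModType R) (g : V -> 'rV[R]_m) x w :
  differentiable g x -> 'D_w (f \o g) x = f ('D_w g x).
Proof.
move=> dg; rewrite derive_comp//; last exact: differentiable_linear_row.
exact: derive_linear_row.
Qed.

End LinearMaps.

(** * The tangent map in arbitrary charts *)

Section TangentMap.
Context {R : realType} {m n : nat} {M : smoothAtlas R m} {N : smoothAtlas R n}.

(** The chain rule applied to [h = (transition b b') \o f \o (transition a' a)],
    where [f] and [h] are the local expressions of [F] in the charts [a], [b] and
    in the charts [a'], [b'] chosen by [tangent_map].  The hypothesis on the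
    domains makes this hold on the whole overlap of [a] and [a']. *)
Lemma tangent_map_in_charts (F : M -> N) x (a : idx M) (b : idx N) w :
  chart_dom a x -> (forall z, chart_dom a z -> chart_dom b (F z)) ->
  differentiable (chart b \o F \o chart_inv a) (chart a x) ->
  tangent_map F (tangent_of a x w) =
  tangent_of b (F x) ('D_w (chart b \o F \o chart_inv a) (chart a x)).
Proof.
move=> ax ab; set f := chart b \o F \o chart_inv a => df.
have bFx := ab _ ax; rewrite /tangent_map.
have := chart_atP x; have := chart_atP (F x).
set b' := chart_at (F x); set a' := chart_at x => b'Fx a'x.
rewrite -(tangent_of_transition _ bFx b'Fx); congr tangent_of.
rewrite tangent_ofE//; set w' := 'D_w _ _.
have fx : f (transition a' a (chart a' x)) = chart b (F x).
  by rewrite transitionE// /f /= chartK.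
have w'E : 'D_w' (transition a' a) (chart a' x) = w.
  by rewrite derive_transition_comp// derive_transitionK.
have dT : differentiable (transition a' a) (chart a' x) := transition_diff a'x ax.
have df' : differentiable f (transition a' a (chart a' x)) by rewrite transitionE.
have dfT : differentiable (f \o transition a' a) (chart a' x).
  exact: differentiable_comp.
transitivity ('D_w' (transition b b' \o (f \o transition a' a)) (chart a' x)).
  apply: near_eq_derive.
  have Ux : overlap a' a (chart a' x) by exists x.
  apply: (nbhs_open (overlap_open M a' a) Ux) => _ [z [a'z az] <-].
  by rewrite /= transitionE// /f /= chartK// chartK// transitionE//; exact: ab.
have dbb' : differentiable (transition b b') ((f \o transition a' a) (chart a' x)).
  by rewrite /= fx; exact: transition_diff.
rewrite (derive_comp _ dfT dbb') (derive_comp _ dT df') w'E /= fx.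
by rewrite transitionE.
Qed.

End TangentMap.

(** * The canonical 2-forms in natural coordinates *)

Section CanonicalFormsInCoordinates.
Context {R : realType} {n : nat}.

Definition momentum_coords k (A : 'I_k) (z : 'rV[R]_(n + k * n)) : 'rV[R]_n :=
  row A (vec_mx (rsubmx z)).

Lemma momentum_coords_linear k (A : 'I_k) : linear (momentum_coords A).
Proof. by move=> c u v; rewrite /momentum_coords !linearP. Qed.

HB.instance Definition _ k (A : 'I_k) :=
  GRing.isLinear.Build R _ _ _ (momentum_coords A) (momentum_coords_linear A).

Lemma lsubmxEcoord k (z : 'rV[R]_(n + k * n)) i :
  lsubmx z 0 i = z 0 (lshift (k * n) i).
Proof. by rewrite mxE. Qed.

Lemma momentum_coordsE k (A : 'I_k) z i :
  momentum_coords A z 0 i = z 0 (rshift n (mxvec_index A i)).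
Proof. by rewrite !mxE. Qed.

Lemma momentum_coords_kchart (M : smoothAtlas R n) k (A : 'I_k)
    (q : kcotangent M k) (a : idx (kcotangent M k)) :
  momentum_coords A (chart a q) = row A (momenta (a : idx M) q).
Proof. by rewrite /momentum_coords /= row_mxKr mxvecK. Qed.

(** The constant bilinear form [\sum_i dx^i /\ dp_i^A]. *)
Definition darboux k (A : 'I_k) (u v : 'rV[R]_(n + k * n)) : R :=
  \sum_i lsubmx u 0 i * momentum_coords A v 0 i -
  \sum_i lsubmx v 0 i * momentum_coords A u 0 i.

Lemma darbouxC k (A : 'I_k) u v : darboux A u v = - darboux A v u.
Proof. by rewrite /darboux opprB. Qed.

Lemma darbouxDl k (A : 'I_k) u u' v :
  darboux A (u + u') v = darboux A u v + darboux A u' v.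
Proof.
rewrite /darboux addrACA -opprD -!big_split /=.
by congr (_ - _); apply: eq_bigr => i _; rewrite linearD !mxE; ring.
Qed.

Lemma darbouxDr k (A : 'I_k) u v v' :
  darboux A u (v + v') = darboux A u v + darboux A u v'.
Proof. by rewrite darbouxC darbouxDl opprD -!darbouxC. Qed.

Lemma darbouxZl k (A : 'I_k) c u v : darboux A (c *: u) v = c * darboux A u v.
Proof.
rewrite /darboux mulrBr !mulr_sumr.
by congr (_ - _); apply: eq_bigr => i _; rewrite linearZ !mxE; ring.
Qed.

Lemma darbouxvv k (A : 'I_k) u : darboux A u u = 0.
Proof. exact: subrr. Qed.

Lemma derive_darboux (V : normedModType R) k (A : 'I_k)
    (f g : V -> 'rV[R]_(n + k * n)) x v :
  differentiable f x -> differentiable g x ->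
  'D_v (fun y => darboux A (f y) (g y)) x =
  darboux A ('D_v f x) (g x) + darboux A (f x) ('D_v g x).
Proof.
move=> df dg.
have D (p p' : {linear 'rV[R]_(n + k * n) -> 'rV[R]_n}) h h' :
    differentiable h x -> differentiable h' x ->
    is_derive x v (fun y => \sum_i p (h y) 0 i * p' (h' y) 0 i)
      (\sum_i p ('D_v h x) 0 i * p' (h' x) 0 i +
       \sum_i p (h x) 0 i * p' ('D_v h' x) 0 i).
  move=> dh dh'.
  have dp : differentiable (p \o h) x.
    by apply: differentiable_comp => //; exact: differentiable_linear_row.
  have dp' : differentiable (p' \o h') x.
    by apply: differentiable_comp => //; exact: differentiable_linear_row.
  by have := is_derive_dot v dp dp'; rewrite !derive_linear_comp// big_split.
have [_ E] := is_deriveB (D (@lsubmx R 1 n (k * n)) (momentum_coords A) f g df dg)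
  (D (@lsubmx R 1 n (k * n)) (momentum_coords A) g f dg df).
apply: etrans E _.
by rewrite /darboux opprD [X in _ + X]addrC addrACA.
Qed.

Lemma smooth_darboux m (U : set 'rV[R]_m) k (A : 'I_k)
    (f g : 'rV[R]_m -> 'rV[R]_(n + k * n)) :
  open U -> smooth_on U f -> smooth_on U g ->
  smooth_on U (fun y => darboux A (f y) (g y)).
Proof.
move=> oU sf sg r.
have C (h : 'rV[R]_m -> 'rV[R]_(n + k * n)) j : smooth_on U h -> Ck r U (fun y => h y 0 j : R).
  by move=> sh; exact: Ck_coord_comp.
apply: (@eq_Ck _ _ _ oU _ r (fun y =>
    \sum_i f y 0 (lshift (k * n) i) * g y 0 (rshift n (mxvec_index A i)) +
    -1 * \sum_i g y 0 (lshift (k * n) i) * f y 0 (rshift n (mxvec_index A i)))).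
  move=> y _; rewrite mulN1r /darboux.
  by congr (_ - _); apply: eq_bigr => i _; rewrite lsubmxEcoord momentum_coordsE.
apply: CkD => //; last apply: CkM => //; first 2 last.
- by apply: Ck_sum => // i; apply: CkM => //; exact: C.
- by apply: Ck_sum => // i; apply: CkM => //; exact: C.
- exact: Ck_cst.
Qed.

End CanonicalFormsInCoordinates.

Section CanonicalForms.
Context {R : realType} {n : nat} {M : smoothAtlas R n}.

(** The coefficients [(p, 0)] of the Liouville form [\sum_i p_i dx^i] with
    respect to the coordinates [(x, p)]. *)
Definition liouville_coords (y : 'rV[R]_(n + 1 * n)) : 'rV[R]_(n + 1 * n) :=
  row_mx (momentum_coords ord0 y) 0.

Lemma liouville_coords_linear : linear liouville_coords.
Proof.
move=> c u v; rewrite /liouville_coords linearP scale_row_mx add_row_mx.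
by rewrite scaler0 addr0.
Qed.

HB.instance Definition _ :=
  GRing.isLinear.Build R _ _ _ liouville_coords liouville_coords_linear.

Lemma liouville_coords_dot (u w : 'rV[R]_(n + 1 * n)) :
  \sum_i liouville_coords u 0 i * w 0 i =
  \sum_i lsubmx w 0 i * momentum_coords ord0 u 0 i.
Proof.
rewrite big_split_ord /= [X in _ + X]big1 ?addr0 => [|i _].
  by apply: eq_bigr => i _; rewrite row_mxEl lsubmxEcoord mulrC.
by rewrite row_mxEr mxE mul0r.
Qed.

(** The coefficients of the Liouville form are linear in the coordinates, so they
    are their own derivatives, and [- d] of the form is [\sum_i dx^i /\ dp_i]. *)
Lemma canonical_symplecticE (q : cotangent_bundle M) a (u v : tangent q) :
  chart_dom a q ->
  canonical_symplectic M u v = darboux ord0 (comp_in u a) (comp_in v a).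
Proof.
move=> aq; rewrite /canonical_symplectic.
rewrite (@ext_d_in_chart _ _ _ _ liouville_coords a)//; first last.
- exact: differentiable_linear_row.
- move=> y w /chart_rangeK[ay yE]; rewrite liouvilleE// liouville_coords_dot.
  apply: eq_bigr => i _; rewrite mulrC; congr (_ * _).
  by rewrite -[in RHS]yE momentum_coords_kchart [RHS]mxE.
by rewrite !derive_linear_row sumrB !liouville_coords_dot opprB.
Qed.

(** The map [(x, p^1, ..., p^k) |-> (x, p^A)], which is [ktau A] read in the
    charts of the two bundles that come from one chart of the base. *)
Definition ktau_coords k (A : 'I_k) (z : 'rV[R]_(n + k * n)) : 'rV[R]_(n + 1 * n) :=
  row_mx (lsubmx z) (mxvec (momentum_coords A z)).

Lemma ktau_coords_linear k (A : 'I_k) : linear (ktau_coords A).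
Proof.
by move=> c u v; rewrite /ktau_coords !linearP scale_row_mx add_row_mx.
Qed.

HB.instance Definition _ k (A : 'I_k) :=
  GRing.isLinear.Build R _ _ _ (ktau_coords A) (ktau_coords_linear A).

Lemma ktau_in_chart k (A : 'I_k) (a : idx (kcotangent M k)) q :
  chart (a : idx (cotangent_bundle M)) (ktau A q) = ktau_coords A (chart a q).
Proof.
rewrite /ktau_coords momentum_coords_kchart /= row_mxKl /kchart.
by congr (row_mx _ (mxvec _)); apply/matrixP => i j; rewrite !mxE.
Qed.

Lemma darboux_ktau k (A : 'I_k) u v :
  darboux ord0 (ktau_coords A u) (ktau_coords A v) = darboux A u v.
Proof.
rewrite /darboux /ktau_coords !row_mxKl.
have E w : momentum_coords (ord0 : 'I_1) (row_mx (lsubmx w)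
    (mxvec (momentum_coords A w))) = momentum_coords A w.
  rewrite /momentum_coords row_mxKr mxvecK.
  by apply/rowP => i; rewrite !mxE.
by rewrite !E.
Qed.

(** Whatever the chart, [ktau A] is linear in natural coordinates and therefore
    acts on tangent vectors by the same formula. *)
Lemma omega0E k (A : 'I_k) (q : kcotangent M k) a (u v : tangent q) :
  chart_dom a q -> omega0 M A u v = darboux A (comp_in u a) (comp_in v a).
Proof.
move=> aq; rewrite /omega0 /pullback.
pose b : idx (cotangent_bundle M) := a.
pose f := chart b \o ktau A \o chart_inv a.
have bq : chart_dom b (ktau A q) by [].
have Uq : chart_range a (chart a q) by exists q.
have fE : \forall z \near chart a q, ktau_coords A z = f z.
  apply: (nbhs_open (chart_range_open a) Uq) => z /chart_rangeK[_ zE].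
  by rewrite /f /= -[in LHS]zE; exact: esym (ktau_in_chart _ _ _).
have df : differentiable f (chart a q).
  by apply: near_eq_differentiable fE _; exact: differentiable_linear_row.
have tE (w : tangent q) : tangent_map (ktau A) w =
    tangent_of b (ktau A q) (ktau_coords A (comp_in w a)).
  rewrite -{1}(tangent_ofK w aq) (@tangent_map_in_charts _ _ _ _ _ _ _ a b)//.
  by rewrite -(near_eq_derive _ fE) derive_linear_row.
by rewrite !tE (canonical_symplecticE _ _ bq) !comp_tangent_of// darboux_ktau.
Qed.

End CanonicalForms.

(** * Lie derivatives and conservation laws *)

Section LieDerivatives.
Context {R : realType} {n k : nat} {M : smoothAtlas R n}.
Implicit Types (A : 'I_k) (q : kcotangent M k) (X Y S : vectorField (kcotangent M k)).

Lemma comp_lie_vf X Y q (a := chart_at q) :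
  'D_(comp_in (X q) a) (local_comp Y a) (chart a q) =
  'D_(comp_in (Y q) a) (local_comp X a) (chart a q) + comp_in (lie_vf X Y q) a.
Proof.
by rewrite /lie_vf comp_tangent_of; [rewrite addrCA subrr addr0|exact: chart_atP].
Qed.

(** The term differentiating the coefficients of the form drops out, because they
    are constant in natural coordinates. *)
Lemma lie_omega0E X A q (u v : tangent q) (a := chart_at q) :
  lie_form2 X (omega0 M A) u v =
  darboux A ('D_(comp_in u a) (local_comp X a) (chart a q)) (comp_in v a) +
  darboux A (comp_in u a) ('D_(comp_in v a) (local_comp X a) (chart a q)).
Proof.
have aq : chart_dom a q by exact: chart_atP.
have Uq : chart_range a (chart a q) by exists q.
rewrite /lie_form2 -/a [X in X + _ + _](_ : _ = 0); last first.
  pose c : 'rV[R]_(n + k * n) -> R := cst (darboux A (comp_in u a) (comp_in v a)).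
  apply: (etrans _ (derive_cst _ _ _)); apply: (near_eq_derive (g := c)).
  apply: (nbhs_open (chart_range_open a) Uq) => y /chart_rangeK[ay _].
  by rewrite (omega0E _ _ _ ay) !comp_tangent_of.
have wE w : comp_in (tangent_of a q w) a = w by exact: comp_tangent_of.
rewrite add0r; congr (_ + _); apply: etrans (omega0E A _ _ aq) _.
  exact: (congr1 (fun w => darboux A w (comp_in v a)) (wE _)).
exact: (congr1 (darboux A (comp_in u a)) (wE _)).
Qed.

Lemma omega0_local A S Y (a : idx (kcotangent M k)) y : chart_range a y ->
  omega0 M A (S (chart_inv a y)) (Y (chart_inv a y)) =
  darboux A (local_comp S a y) (local_comp Y a y).
Proof. by move=> /chart_rangeK[ay _]; exact: omega0E. Qed.

(** The Leibniz rule: in coordinates the derivatives of [S] and [Y] along [X]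
    are their Lie brackets with [X] plus the derivatives of [X] along [S] and
    [Y], and the latter make up the Lie derivative of the form. *)
Lemma lie_fun_omega0 X A S Y q :
  lie_fun X (fun p => omega0 M A (S p) (Y p)) q =
  lie_form2 X (omega0 M A) (S q) (Y q) +
  omega0 M A (lie_vf X S q) (Y q) + omega0 M A (S q) (lie_vf X Y q).
Proof.
rewrite lie_omega0E /lie_fun /differential.
have := comp_lie_vf X S q; have := comp_lie_vf X Y q; have := chart_atP q.
set a := chart_at q => aq YE SE.
have Uq : chart_range a (chart a q) by exists q.
have loc (Z : vectorField (kcotangent M k)) : local_comp Z a (chart a q) = comp_in (Z q) a.
  by rewrite /local_comp chartK.
have dloc (Z : vectorField (kcotangent M k)) : differentiable (local_comp Z a) (chart a q).
  by apply: smooth_differentiable Uq; exact: vfield_smooth.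
rewrite (@near_eq_derive _ _ _ _
  (fun y => darboux A (local_comp S a y) (local_comp Y a y))); last first.
  by apply: (nbhs_open (chart_range_open a) Uq) => y; exact: omega0_local.
rewrite derive_darboux// YE SE !loc !(omega0E _ _ _ aq).
by rewrite darbouxDl darbouxDr addrACA addrA.
Qed.

Lemma smooth_omega0 A S Y : smooth_fun (fun q => omega0 M A (S q) (Y q)).
Proof.
move=> a; apply: eq_smooth (smooth_darboux A (chart_range_open a)
  (vfield_smooth S a) (vfield_smooth Y a)); first exact: chart_range_open.
by move=> y ay /=; rewrite omega0_local.
Qed.

Lemma omega0_collinear A q (c : R) (u : tangent q) : omega0 M A (c *: u) u = 0.
Proof.
rewrite !(omega0E _ _ _ (chart_atP q)).
by rewrite darbouxZl darbouxvv mulr0.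
Qed.

Lemma pseudosymmetry_conservation_law (X : kvectorField (kcotangent M k) k) Y S :
  (forall A q (u v : tangent q), lie_form2 (X A) (omega0 M A) u v = 0) ->
  is_symmetry X Y -> is_pseudosymmetry (fun _ : 'I_k => Y) X S ->
  conservation_law X (fun q => \row_(A < k) omega0 M A (S q) (Y q)).
Proof.
move=> XO XY XS; split=> [a|q].
  apply: smooth_row => [|A r]; first exact: chart_range_open.
  apply: (eq_Ck (chart_range_open a) _ (smooth_omega0 A S Y a r)) => y _ /=.
  by rewrite mxE.
apply: big1 => A _.
have -> : (fun p => (\row_(B < k) omega0 M B (S p) (Y p)) 0 A) =
    (fun p => omega0 M A (S p) (Y p)) by apply/funext => p; rewrite mxE.
have [lambda [_ SE]] := XS A.
rewrite lie_fun_omega0 XO XY SE -scaler_suml add0r omega0_collinear add0r.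
rewrite (omega0E _ _ _ (chart_atP q)) darbouxC.
have -> : comp_in (0 : tangent q) (chart_at q) = 0 *: 0 by rewrite scale0r.
by rewrite darbouxZl mul0r oppr0.
Qed.

Lemma symmetry_pseudosymmetry (X Z : kvectorField (kcotangent M k) k) S :
  is_symmetry X S -> is_pseudosymmetry Z X S.
Proof.
move=> XS A; exists (fun _ => cst 0); split=> [B a r|q].
  exact: (Ck_cst (chart_range_open a)).
by rewrite XS big1// => B _; rewrite scale0r.
Qed.

End LieDerivatives.

Theorem corollary5p8 (R : realType) (n k : nat) (M : manifold R n)
    (H : kcotangent M k -> R) (X : kvectorField (kcotangent M k) k)
    (Y : vectorField (kcotangent M k)) :
  smooth_fun H ->
  integrable_kvf X ->
  evolution_kvf H X ->
  (forall (A : 'I_k) (q : kcotangent M k) (u v : tangent q),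
     lie_form2 (X A) (omega0 M A) u v = 0) ->
  is_symmetry X Y ->
  (forall S : vectorField (kcotangent M k),
     is_pseudosymmetry (fun _ : 'I_k => Y) X S ->
     conservation_law X
       (fun q : kcotangent M k => \row_(A < k) omega0 M A (S q) (Y q))) /\
  (forall S : vectorField (kcotangent M k),
     is_symmetry X S ->
     conservation_law X
       (fun q : kcotangent M k => \row_(A < k) omega0 M A (S q) (Y q))).
Proof.
move=> _ _ _ XO XY; split=> S XS.
  exact: pseudosymmetry_conservation_law.
by apply: pseudosymmetry_conservation_law => //; exact: symmetry_pseudosymmetry.
Qed.
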